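(* Let $n\ge 2$ and let $L$ be a nilpotent $n$-Lie superalgebra over a field $\mathbb{F}$ of characteristic zero such that $\dim L=(m|k)$, $\dim Z(L)=(p|q)$ and $\dim L^2=(1|0)$. Then $$\begin{aligned}\dim\mathcal{M}(L)\leq{}& \sum_{i=0}^{n}\left[\binom{p-1}{i}\mathcal{L}(n-i,q)+\binom{m-p+1}{i}\mathcal{L}(n-i,k-q)\right]\\ &+\sum_{i=1}^{n-1}\left[\left(\sum_{j=0}^{i}\binom{p-1}{j}q^{\,i-j}\right)\left(\sum_{j=0}^{n-i}\binom{m-p}{j}(k-q)^{\,n-i-j}\right)\right]-1,\end{aligned}$$ where, for an integer $r\ge 0$, $\mathcal{L}(0,r)=1$ and $\mathcal{L}(t,r)=\sum_{j=1}^{t}\binom{t-1}{j-1}\binom{r}{j}$ for $1\le t\le n$, and $0^0=1$.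
   Context: Fix a field $\mathbb{F}$ of characteristic zero and an integer $n\ge 2$. A superspace is a $\mathbb{Z}_2$-graded vector space $V=V_0\oplus V_1$; elements of $V_a$ ($a\in\mathbb{Z}_2$) are homogeneous of degree $|v|=a$. A sub-superspace is a subspace $U$ with $U=(U\cap V_0)\oplus(U\cap V_1)$. An $n$-Lie superalgebra is a superspace $L=L_0\oplus L_1$ with an $n$-linear bracket $[-,\ldots,-]:L^{\times n}\to L$ such that for homogeneous elements: (i) $|[x_1,\ldots,x_n]|=\sum_i|x_i|$ mod 2; (ii) $[x_1,\ldots,x_i,x_{i+1},\ldots,x_n]=-(-1)^{|x_i||x_{i+1}|}[x_1,\ldots,x_{i+1},x_i,\ldots,x_n]$; (iii) $[x_1,\ldots,x_{n-1},[y_1,\ldots,y_n]]=[[x_1,\ldots,x_{n-1},y_1],y_2,\ldots,y_n]+\sum_{i=2}^{n}(-1)^{(\sum_{j=1}^{i-1}|y_j|)(|x_1|+\cdots+|x_{n-1}|)}[y_1,\ldots,y_{i-1},[x_1,\ldots,x_{n-1},y_i],y_{i+1},\ldots,y_n]$. A graded ideal is a sub-superspace $I$ with $[I,L,\ldots,L]\subseteq I$. The center is $Z(L)=\{z\in L\mid [z,L,\ldots,L]=0\}$ and $L^2=[L,\ldots,L]$ is the span of all brackets; both are graded ideals. Put $L^1=L$ and $L^{i+1}=[L^i,L,\ldots,L]$ for $i\ge1$; $L$ is nilpotent of class $c$ if $L^{c+1}=0$ and $L^c\ne0$. Homomorphisms are degree-preserving linear maps respecting brackets. The Schur multiplier of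 $L$ is $\mathcal{M}(L)=\dfrac{R\cap F^2}{[R,F,\ldots,F]}$, where $0\to R\to F\to L\to 0$ is a free presentation of $L$ (a short exact sequence with $F$ a free $n$-Lie superalgebra); up to isomorphism it is independent of the free presentation. For a superspace $V$, $\dim V=(a|b)$ means $\dim V_0=a$ and $\dim V_1=b$ (both finite); in inequalities, $\dim$ denotes total dimension. *)

(* Defs.v *)
From HB Require Import structures.
From mathcomp Require Import all_boot all_order all_fingroup all_algebra.
From mathcomp Require Import classical_sets.

Set Implicit Arguments.
Unset Strict Implicit.
Unset Printing Implicit Defensive.

Import GRing.Theory.

Local Open Scope classical_set_scope.
Local Open Scope ring_scope.

Section LinearAlgebra.
Variables (K : fieldType) (V : lmodType K).

Definition subspace (A : set V) : Prop :=
  A 0 /\ forall (a : K) (u v : V), A u -> A v -> A (a *: u + v).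

Definition span (S : set V) : set V :=
  [set v | exists (r : nat) (c : 'I_r -> K) (w : 'I_r -> V),
     (forall i, S (w i)) /\ v = \sum_(i < r) c i *: w i].

(* For subspaces B `<=` A: the quotient A / B is finite-dimensional of
   dimension d, i.e. the classes modulo B of some b_0, ..., b_(d-1) in A form
   a basis of A / B. *)
Definition quot_dim (A B : set V) (d : nat) : Prop :=
  exists2 b : 'I_d -> V, (forall i, A (b i)) &
    forall v, A v ->
      exists! c : {ffun 'I_d -> K}, B (v - \sum_(i < d) c i *: b i).

Definition sub_dim (A : set V) (d : nat) : Prop := quot_dim A [set 0] d.

End LinearAlgebra.

(* The group Z_2 is bool with addb; [spart V a] is V_a. *)
Record superspace (K : fieldType) := Superspace {
  scarrier :> lmodType K;
  spart : bool -> set scarrier;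
  spart_subspace : forall a, subspace (spart a);
  spart_sum : forall v : scarrier,
    exists v0 v1, [/\ spart false v0, spart true v1 & v = v0 + v1];
  spart_cap : spart false `&` spart true `<=` [set 0]
}.
Arguments spart {K} V a : rename.

(* dim A = (a|b), for a sub-superspace A of V. *)
Definition sdim (K : fieldType) (V : superspace K) (A : set V) (a b : nat) :
    Prop :=
  sub_dim (A `&` spart V false) a /\ sub_dim (A `&` spart V true) b.

Section Arguments.
Variables (n : nat) (T : Type).

Definition upd (x : {ffun 'I_n -> T}) (i : 'I_n) (u : T) : {ffun 'I_n -> T} :=
  [ffun j => if j == i then u else x j].

(* (x_1, ..., x_(n-1), y), for n > 0 *)
Definition append_last (x : {ffun 'I_n.-1 -> T}) (y : T) : {ffun 'I_n -> T} :=
  [ffun j : 'I_n => if insub (val j) is Some i then x i else y].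

End Arguments.

(* Homogeneity is a hypothesis [spart V (d i) (x i)], so that 0 has both
   degrees. In [nfundamental] the term for i = 0 carries an empty sum of
   degrees, hence the sign +1. *)
Record nLieSuper (K : fieldType) (n : nat) := NLieSuper {
  nspace :> superspace K;
  nbr : {ffun 'I_n -> nspace} -> nspace;
  nbr_linear : forall (x : {ffun 'I_n -> nspace}) (i : 'I_n) (a : K)
      (u v : nspace),
    nbr (upd x i (a *: u + v)) = a *: nbr (upd x i u) + nbr (upd x i v);
  nbr_degree : forall (d : 'I_n -> bool) (x : {ffun 'I_n -> nspace}),
    (forall i, spart nspace (d i) (x i)) ->
    spart nspace (odd (\sum_(i < n) d i)) (nbr x);
  nbr_skew : forall (d : 'I_n -> bool) (x : {ffun 'I_n -> nspace})
      (i j : 'I_n),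
    (forall l, spart nspace (d l) (x l)) -> j = i.+1 :> nat ->
    nbr x = - ((-1) ^+ (d i * d j)%N *: nbr [ffun l => x (tperm i j l)]);
  nfundamental : forall (dx : 'I_n.-1 -> bool) (dy : 'I_n -> bool)
      (x : {ffun 'I_n.-1 -> nspace}) (y : {ffun 'I_n -> nspace}),
    (forall i, spart nspace (dx i) (x i)) ->
    (forall i, spart nspace (dy i) (y i)) ->
    nbr (append_last x (nbr y)) =
    \sum_(i < n)
      (-1) ^+ ((\sum_(j < n | (j < i)%N) dy j) * (\sum_(j < n.-1) dx j))%N *:
        nbr (upd y i (nbr (append_last x (y i))))
}.
Arguments nbr {K n L} x : rename.

Section Subobjects.
Variables (K : fieldType) (n : nat) (L : nLieSuper K n).

(* [A, L, ..., L] *)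
Definition bracket_with (A : set L) : set L :=
  span [set v | exists2 x : {ffun 'I_n -> L},
                  (forall i : 'I_n, i = 0%N :> nat -> A (x i)) & v = nbr x].

(* L^i for i >= 1 *)
Definition lower_central (i : nat) : set L := iter i.-1 bracket_with setT.

Definition nilpotent_of_class (c : nat) : Prop :=
  lower_central c.+1 = [set 0] /\ lower_central c <> [set 0].

Definition nilpotent : Prop := exists c, nilpotent_of_class c.

Definition center : set L :=
  [set z | forall x : {ffun 'I_n -> L},
     (forall i : 'I_n, i = 0%N :> nat -> x i = z) -> nbr x = 0].

End Subobjects.

Arguments lower_central {K n} L i.
Arguments nilpotent {K n} L.
Arguments center {K n} L.

Definition is_hom (K : fieldType) (n : nat) (L M : nLieSuper K n)
    (f : {linear L -> M}) : Prop :=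
  (forall a v, spart L a v -> spart M a (f v)) /\
  (forall x : {ffun 'I_n -> L}, f (nbr x) = nbr [ffun i => f (x i)]).

(* F is free on the Z_2-graded set (X, deg), embedded by iota. *)
Definition is_free (K : fieldType) (n : nat) (F : nLieSuper K n)
    (X : Type) (deg : X -> bool) (iota : X -> F) : Prop :=
  (forall x, spart F (deg x) (iota x)) /\
  forall (M : nLieSuper K n) (g : X -> M),
    (forall x, spart M (deg x) (g x)) ->
    exists2 f : {linear F -> M}, is_hom f /\ (forall x, f (iota x) = g x) &
      forall f' : {linear F -> M},
        is_hom f' -> (forall x, f' (iota x) = g x) -> f' =1 f.

Record free_presentation (K : fieldType) (n : nat) (L : nLieSuper K n) :=
  FreePresentation {
  fp_alg : nLieSuper K n;
  fp_gen : Type;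
  fp_deg : fp_gen -> bool;
  fp_incl : fp_gen -> fp_alg;
  fp_free : is_free fp_deg fp_incl;
  fp_map : {linear fp_alg -> L};
  fp_hom : is_hom fp_map;
  fp_surj : forall y : L, exists x, fp_map x = y
}.

Definition fp_rel (K : fieldType) (n : nat) (L : nLieSuper K n)
    (P : free_presentation L) : set (fp_alg P) :=
  [set x | fp_map P x = 0].
Arguments fp_rel {K n L} P _.

(* The Schur multiplier (R `&` F^2) / [R, F, ..., F] computed from the free
   presentation P has total dimension d. *)
Definition multiplier_dim (K : fieldType) (n : nat) (L : nLieSuper K n)
    (P : free_presentation L) (d : nat) : Prop :=
  quot_dim (fp_rel P `&` lower_central (fp_alg P) 2)
           (bracket_with (fp_rel P)) d.

(* The number of multisets of size t on r elements, 'C(r + t - 1, t). *)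
Definition calL (t r : nat) : nat :=
  if t == 0%N then 1%N
  else (\sum_(1 <= j < t.+1) 'C(t.-1, j.-1) * 'C(r, j))%N.

(* Main.v *)
Require Import Defs.
From HB Require Import structures.
From mathcomp Require Import all_boot all_order all_fingroup all_algebra.
From mathcomp Require Import boolp classical_sets.
From mathcomp Require Import zify.

Import Defs.

Set Implicit Arguments.
Unset Strict Implicit.
Unset Printing Implicit Defensive.

Import GRing.Theory.

Local Open Scope classical_set_scope.
Local Open Scope ring_scope.

(* Write L = F/R and W = [R, F, ..., F].  Since L is nilpotent, L^2 is a line
   spanned by a central even bracket z.  Lift to F homogeneous families A, z, B
   such that A and z span Z(L), and A, z, B span L, with A of dimension
   (p-1|q) and B of dimension (m-p|k-q).  The bracket of F modulo W is a
   super-alternating map on L, so F^2/W is spanned by the sorted monomials of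
   degree n in A, z, B in which even letters are not repeated.  By the
   fundamental identity, a monomial containing z and a letter of A vanishes
   modulo W.  The remaining monomials are those in A only, those in z and B
   only, and the mixed ones in A and B; counting them bounds dim F^2/W, and
   dim M(L) = dim F^2/W - dim L^2. *)

(** * Spanning families modulo a subspace *)

Section Subspaces.
Context {K : fieldType} {V : lmodType K}.
Implicit Types (A B S : set V) (u v : V).

Lemma subspaceD S u v : subspace S -> S u -> S v -> S (u + v).
Proof. by move=> [_ HS] Su Sv; rewrite -[u]scale1r; apply: HS. Qed.

Lemma subspaceZ S a u : subspace S -> S u -> S (a *: u).
Proof. by move=> [S0 HS] Su; rewrite -[_ *: _]addr0; apply: HS. Qed.

Lemma subspaceN S u : subspace S -> S u -> S (- u).
Proof. by move=> HS Su; rewrite -scaleN1r; apply: subspaceZ. Qed.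

Lemma subspaceB S u v : subspace S -> S u -> S v -> S (u - v).
Proof. by move=> HS Su Sv; apply: subspaceD => //; apply: subspaceN. Qed.

Lemma subspace_sum S (I : Type) (r : seq I) (P : pred I) (F : I -> V) :
  subspace S -> (forall i, P i -> S (F i)) -> S (\sum_(i <- r | P i) F i).
Proof.
move=> HS HF; elim/big_rec: _ => [|i x Pi Sx]; first by case: HS.
by apply: subspaceD => //; apply: HF.
Qed.

Lemma span_min A S : subspace S -> A `<=` S -> span A `<=` S.
Proof.
move=> HS AS v [r [c [w [Aw ->]]]]; apply: subspace_sum => // i _.
by apply: subspaceZ => //; apply: AS.
Qed.

Lemma sub_span A : A `<=` span A.
Proof.
move=> v Av; exists 1%N, (fun=> 1), (fun=> v); split=> //.
by rewrite big_ord1 scale1r.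
Qed.

Lemma span_subspace A : subspace (span A).
Proof.
split.
  exists 0%N, (fun=> 0), (fun=> 0); split; first by case.
  by rewrite big_ord0.
move=> a _ _ [r1 [c1 [w1 [A1 ->]]]] [r2 [c2 [w2 [A2 ->]]]].
exists (r1 + r2)%N,
  (fun i => match split i with inl j => a * c1 j | inr j => c2 j end),
  (fun i => match split i with inl j => w1 j | inr j => w2 j end); split.
  by move=> i; case: (split i).
rewrite big_split_ord scaler_sumr; congr (_ + _); apply: eq_bigr => i _.
  by rewrite (unsplitK (inl i)) scalerA.
by rewrite (unsplitK (inr i)).
Qed.

Lemma span_mono A B : A `<=` B -> span A `<=` span B.
Proof.
move=> AB; apply: span_min; first exact: span_subspace.
by move=> v /AB; apply: sub_span.
Qed.

(** For a subspace [B], the preimage in [V] of the span of the classes of the [b i] in [V / B]; the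
    quotient itself is never formed. *)
Definition span_mod B d (b : 'I_d -> V) : set V :=
  [set v | exists c : 'I_d -> K, B (v - \sum_(i < d) c i *: b i)].

Lemma span_mod_subspace B d (b : 'I_d -> V) :
  subspace B -> subspace (span_mod B b).
Proof.
move=> HB; split.
  exists (fun=> 0); rewrite big1 ?subr0; first by case: HB.
  by move=> i _; rewrite scale0r.
move=> a u v [c Bc] [c' Bc'].
exists (fun i => a * c i + c' i).
rewrite [X in B X](_ : _ = a *: (u - \sum_(i < d) c i *: b i)
                        + (v - \sum_(i < d) c' i *: b i)).
  by apply: subspaceD => //; apply: subspaceZ.
rewrite scalerBr scaler_sumr addrACA -opprD -big_split /=.
by congr (_ - _); apply: eq_bigr => i _; rewrite scalerDl scalerA.
Qed.

Lemma span_mod_sub B d (b : 'I_d -> V) : B `<=` span_mod B b.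
Proof.
move=> v Bv; exists (fun=> 0); rewrite big1 ?subr0 // => i _.
by rewrite scale0r.
Qed.

Lemma span_mod_gen B d (b : 'I_d -> V) i : subspace B -> span_mod B b (b i).
Proof.
move=> HB; exists (fun j => (j == i)%:R).
rewrite (bigD1 i) //= eqxx scale1r big1 ?addr0 ?subrr; first by case: HB.
by move=> j /negPf ->; rewrite scale0r.
Qed.

Lemma span_mod_drop B d (b : 'I_d.+1 -> V) (e : 'I_d.+1 -> K) i0 :
    subspace B -> B (\sum_i e i *: b i) -> e i0 != 0 ->
  span_mod B b `<=` span_mod B (fun j => b (lift i0 j)).
Proof.
move=> HB Be ei0 v [c Bc].
(* The relation gives [b i0] modulo [B] as the combination of the other vectors with coefficients
   [- e (lift i0 j) / e i0], which is substituted into the combination for [v]. *)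
exists (fun j => c (lift i0 j) - c i0 / e i0 * e (lift i0 j)).
have -> : v - \sum_(j < d) (c (lift i0 j) - c i0 / e i0 * e (lift i0 j))
                *: b (lift i0 j)
  = (v - \sum_(i < d.+1) c i *: b i)
    + (c i0 / e i0) *: (\sum_(i < d.+1) e i *: b i).
  rewrite -addrA; congr (_ + _).
  rewrite !(bigD1_ord i0) //= scalerDr scalerA divfK // opprD.
  rewrite [RHS]addrACA [- _ + c i0 *: _]addrC subrr add0r.
  rewrite scaler_sumr -sumrN -sumrN -big_split /=.
  apply: eq_bigr => j _; rewrite scalerBl scalerA opprB addrC.
  by rewrite addrC.
by apply: subspaceD => //; apply: subspaceZ.
Qed.

(** As long as a nontrivial relation modulo [B] exists, one vector is dropped; once none exists,
    coordinates modulo [B] are unique. *)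
Lemma quot_dim_le A B d (b : 'I_d -> V) :
    subspace B -> (forall i, A (b i)) -> A `<=` span_mod B b ->
  exists2 d', (d' <= d)%N & quot_dim A B d'.
Proof.
move=> HB.
elim: d b => [|d IHd] b Ab sAb.
  exists 0%N => //; exists b => // v /sAb [c Bc].
  exists [ffun i => c i]; split; first by under eq_bigr do rewrite ffunE.
  by move=> c' _; apply/ffunP; case.
have [[e [i0 [Be ei0]]]|Hind] := pselect (exists (e : 'I_d.+1 -> K) i0,
    B (\sum_i e i *: b i) /\ e i0 != 0).
  have [|d' le_d' Hd'] := IHd (fun j => b (lift i0 j)) (fun=> Ab _).
    by move=> v /sAb; apply: span_mod_drop Be ei0 _.
  by exists d' => //; apply: leqW.
exists d.+1 => //; exists b => // v /sAb [c Bc].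
exists [ffun i => c i]; split; first by under eq_bigr do rewrite ffunE.
move=> c' Bc'; apply/ffunP => i; rewrite ffunE; apply/eqP.
apply: contrapT => /negP ci; apply: Hind.
exists (fun i => c' i - c i), i; split; last by rewrite subr_eq0 eq_sym.
under eq_bigr do rewrite scalerBl.
rewrite sumrB.
have := subspaceB HB Bc Bc'.
by rewrite opprB addrC addrA subrK.
Qed.

Lemma lincomb_mulmx a b (s : 'rV[K]_b) (M : 'M[K]_(b, a)) (u : 'I_a -> V) :
  \sum_k (s *m M) 0 k *: u k = \sum_i s 0 i *: (\sum_k M i k *: u k).
Proof.
under eq_bigr do rewrite mxE scaler_suml.
rewrite exchange_big; apply: eq_bigr => i _; rewrite scaler_sumr.
by apply: eq_bigr => k _; rewrite scalerA.
Qed.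

Lemma complement_family A B a b :
    subspace A -> subspace B -> B `<=` A -> sub_dim A a -> sub_dim B b ->
  exists2 w : 'I_(a - b) -> V, (forall i, A (w i)) & A `<=` span_mod B w.
Proof.
move=> HA HB BA [u Au Hu] [v Bv Hv].
have coordA x : A x -> exists c : 'rV[K]_a, x = \sum_k c 0 k *: u k.
  move=> /Hu [c [/eqP]]; rewrite subr_eq0 => /eqP -> _.
  by exists (\row_k c k); apply: eq_bigr => k _; rewrite mxE.
have /choice [r Hr] : forall i, exists c : 'rV[K]_a, v i = \sum_k c 0 k *: u k.
  by move=> i; apply/coordA/BA.
pose C := \matrix_(i < b) r i.
have HC i : v i = \sum_k C i k *: u k.
  by rewrite Hr; apply: eq_bigr => k _; rewrite mxE.
(* A row [x] killed by [C] and the zero row are both coordinates of the vector 0 over [v], so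
   uniqueness identifies them. *)
have freeC : row_free C.
  apply: inj_row_free => x xC0; have [c [_ c_uniq]] := Hv 0 (proj1 HB).
  have /ffunP x0 : [ffun i => x 0 i] = [ffun=> 0].
    transitivity c; [symmetry|]; apply: c_uniq => /=.
      under eq_bigr do rewrite ffunE HC.
      by rewrite -lincomb_mulmx xC0 big1 ?subrr // => i _; rewrite mxE scale0r.
    by rewrite big1 ?subrr // => i _; rewrite ffunE scale0r.
  by apply/rowP => i; move: (x0 i); rewrite !ffunE mxE.
have [D CD] : exists D : 'M[K]_(a - b, a), row_full (C + D)%MS.
  have <- : \rank C^C%MS = (a - b)%N by rewrite mxrank_compl (eqP freeC).
  exists (row_base C^C%MS); rewrite -sub1mx.
  by rewrite (adds_eqmx (eqmx_refl C) (eq_row_base _)) sub1mx addsmx_compl_full.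
exists (fun j => \sum_k D j k *: u k).
  by move=> j; apply: subspace_sum => // k _; apply: subspaceZ.
move=> x /coordA [c ->].
have /sub_addsmxP [[s t] /= ->] : (c <= C + D)%MS by apply: submx_full.
exists (fun j => t 0 j).
under eq_bigr do rewrite mxE scalerDl.
rewrite big_split /= !lincomb_mulmx addrK.
by apply: subspace_sum => // i _; apply: subspaceZ => //; rewrite -HC.
Qed.

Lemma subspaceI A B :
  subspace A -> subspace B -> subspace (A `&` B).
Proof.
move=> [A0 HA] [B0 HB]; split=> // a u v [Au Bu] [Av Bv].
by split; [apply: HA | apply: HB].
Qed.

Lemma span_mod_min B S d (b : 'I_d -> V) :
  subspace S -> B `<=` S -> (forall i, S (b i)) -> span_mod B b `<=` S.
Proof.
move=> HS BS Sb v [c /BS Sv]; rewrite -[v](subrK (\sum_(i < d) c i *: b i)).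
by apply: subspaceD => //; apply: subspace_sum => // i _; apply: subspaceZ.
Qed.

Lemma subspace_line (z : V) :
  subspace [set v | exists c, v = c *: z].
Proof.
split=> [|a _ _ [c ->] [c' ->]]; first by exists 0; rewrite scale0r.
by exists (a * c + c'); rewrite scalerDl scalerA.
Qed.

End Subspaces.

(** On [A] the map [f] has rank one, so its kernel there needs one generator fewer. This produces
    the final [- 1] of the bound. *)
Lemma span_mod_kernel (K : fieldType) (V U : lmodType K) (f : {linear V -> U})
    (A B : set V) d (b : 'I_d -> V) (z : U) :
    subspace A -> subspace B -> (forall i, A (b i)) -> A `<=` span_mod B b ->
    (forall v, A v -> exists c, f v = c *: z) -> (forall v, B v -> f v = 0) ->
    (exists2 v, A v & f v != 0) ->
  (0 < d)%N /\ exists2 b' : 'I_d.-1 -> V, (forall i, f (b' i) = 0 /\ A (b' i)) &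
    [set v | f v = 0] `&` A `<=` span_mod B b'.
Proof.
move=> HA HB Ab sAb fA fB [v0 Av0 fv0].
have [e He] := choice (fun i => fA _ (Ab i)).
have fsum (c : 'I_d -> K) : f (\sum_i c i *: b i) = (\sum_i c i * e i) *: z.
  rewrite linear_sum scaler_suml; apply: eq_bigr => i _.
  by rewrite linearZ /= He scalerA.
have z0 : z != 0.
  by apply: contra fv0 => /eqP z0; have [c ->] := fA _ Av0; rewrite z0 scaler0.
have [i0 ei0] : exists i0, e i0 != 0.
  apply: contrapT => He0; have [c Bc] := sAb _ Av0.
  move/negP: fv0; apply; move/fB/eqP: Bc; rewrite linearB /= fsum.
  rewrite big1 ?scale0r ?subr0 //.
  move=> i _; have [->|ei] := eqVneq (e i) 0; first by rewrite mulr0.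
  by case: He0; exists i.
case: d => [|d] in b Ab sAb e He fsum i0 ei0 *; first by case: i0 ei0.
split=> //.
(* Since [f (b i0)] spans the line, subtracting a multiple of [b i0] moves each other vector into
   the kernel. *)
exists (fun j => b (lift i0 j) - (e (lift i0 j) / e i0) *: b i0) => /=.
  move=> j; split; last by apply: subspaceB => //; apply: subspaceZ.
  by rewrite linearB linearZ /= !He scalerA divfK // subrr.
move=> v [/= fv0' Av]; have [c Bc] := sAb _ Av.
have := fB _ Bc; rewrite linearB /= fv0' sub0r fsum => /eqP.
rewrite oppr_eq0 scaler_eq0 (negPf z0) orbF (bigD1_ord i0) //= addr_eq0.
move=> /eqP ce.
exists (fun j => c (lift i0 j)); move: Bc; congr B; congr (_ - _).
rewrite (bigD1_ord i0) //=; under [RHS]eq_bigr do rewrite scalerBr scalerA.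
rewrite sumrB -scaler_suml [LHS]addrC; congr (_ + _).
rewrite -scaleNr; congr (_ *: _).
rewrite -[LHS](mulfK ei0) ce mulNr mulr_suml; congr (- _).
by apply: eq_bigr => j _; rewrite mulrA.
Qed.

(** * Counting monomials *)

Lemma calL0 r : calL 0 r = 1%N. Proof. by []. Qed.

Lemma calLS_0 t : calL t.+1 0 = 0%N.
Proof.
rewrite /calL /= big_nat_cond big1 // => j; rewrite andbT => /andP[j_gt0 _].
by rewrite (@bin_small 0) ?muln0.
Qed.

(** Vandermonde's convolution, whose additional term at index 0 is ['C(t, t.+1) = 0]. *)
Lemma calL_bin t r : calL t.+1 r = 'C(r + t, t.+1).
Proof.
rewrite -binomial.Vandermonde /calL /= big_add1 /= big_mkord.
rewrite [RHS]big_ord_recl /= subn0 (@bin_small t) // muln0 add0n.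
apply: eq_bigr => j _; rewrite /bump /= add1n subSS mulnC.
rewrite bin_sub; [reflexivity|by rewrite -ltnS].
Qed.

(** Pascal's rule: a multiset avoids the new letter or contains it at least once. *)
Lemma calLSS t r : calL t.+1 r.+1 = (calL t.+1 r + calL t r.+1)%N.
Proof.
case: t => [|t]; first by rewrite !calL_bin !addn0 !bin1 addn1.
by rewrite !calL_bin addSn binS addSnnS.
Qed.

(** There are at most as many multisets as words. This yields the powers in the mixed terms of the
    bound; at [t = 0] both sides are 1, even for [r = 0]. *)
Lemma calL_exp t r : (calL t r <= r ^ t)%N.
Proof.
elim: r t => [|r IHr] [|t]; rewrite ?calL0 ?calLS_0 //.
elim: t => [|t IHt]; first by rewrite calL_bin addn0 bin1.
rewrite calLSS expnS mulSn addnC leq_add // (leq_trans (IHr _)) //.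
by rewrite expnS leq_mul // leq_exp2r.
Qed.

Section Monomials.
Context {T : eqType}.
Implicit Types (E u : seq T).

(** [M] covers all words up to order. A word over [x :: E] either avoids [x] or is, up to order, [x]
    followed by a shorter word, which is the recursion of [calLSS]. *)
Lemma multisets_upto_perm E t : exists2 M : seq (seq T),
  size M = calL t (size E) &
  forall u, size u = t -> {subset u <= E} -> exists2 v, v \in M & perm_eq u v.
Proof.
elim: E t => [|x E IHE] t.
  case: t => [|t]; [exists [:: [::]] | exists [::]] => //.
  - by move=> u /size0nil ->; exists [::].
  - by rewrite calLS_0.
  - by case=> [|y u] // _ /(_ y); rewrite mem_head in_nil => /(_ isT).
elim: t => [|t [M1 sM1 HM1]].
  by exists [:: [::]] => // u /size0nil ->; exists [::].
have [M2 sM2 HM2] := IHE t.+1.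
exists (M2 ++ map (cons x) M1).
  by rewrite size_cat size_map sM1 sM2 calLSS.
move=> u su uE; have [xu|xu] := boolP (x \in u).
  have [||v Mv uv] := HM1 (rem x u).
  - by rewrite size_rem // su.
  - by move=> y /mem_rem /uE.
  exists (x :: v); first by rewrite mem_cat map_f ?orbT.
  by rewrite (perm_trans (perm_to_rem xu)) ?perm_cons.
have [//||v Mv uv] := HM2 u.
  move=> y yu; move: (uE y yu); rewrite inE => /predU1P [yx|//].
  by rewrite -yx yu in xu.
by exists v => //; rewrite mem_cat Mv.
Qed.

(** [E0] stands for the even letters and [E1] for the odd ones. Each letter of [E0] occurs once or
    not at all, which matches Pascal's rule for ['C(size E0, j)]. *)
Lemma supermonomials_upto_perm E0 E1 t : exists M : seq (seq T),
  size M = (\sum_(0 <= j < t.+1) 'C(size E0, j) * calL (t - j) (size E1))%N /\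
  forall u, size u = t -> {subset u <= E0 ++ E1} ->
    (forall x, x \in E0 -> (count_mem x u <= 1)%N) ->
  exists2 v, v \in M & perm_eq u v.
Proof.
elim: E0 t => [|x E IHE] t /=.
  have [M sM HM] := multisets_upto_perm E1 t; exists M; split; last first.
    by move=> u su uE _; apply: HM.
  rewrite big_nat_recl // big_nat big1 ?addn0 ?mul1n ?subn0 //.
case: t => [|t].
  exists [:: [::]]; split; first by rewrite big_nat1 bin0.
  by move=> u /size0nil ->; exists [::].
have [M1 [sM1 HM1]] := IHE t.+1; have [M2 [sM2 HM2]] := IHE t.
exists (M1 ++ map (cons x) M2); split.
  rewrite size_cat size_map sM1 sM2 big_nat_recl // [RHS]big_nat_recl //.
  rewrite !bin0 -addnA -big_split /=; congr (_ + _)%N.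
  by apply: eq_bigr => j _; rewrite binS mulnDl subSS.
move=> u su uE u1.
have uE' y : y \in u -> y != x -> y \in E ++ E1.
  by move=> /uE; rewrite inE => /predU1P [->|//]; rewrite eqxx.
have [xu|xu] := boolP (x \in u).
  have pu := perm_to_rem xu.
  have cx : x \notin rem x u.
    have := u1 x (mem_head _ _); rewrite (seq.permP pu) /= eqxx.
    rewrite -has_pred1 has_count.
    by case: (count _ _).
  have [|||v Mv uv] := HM2 (rem x u).
  - by rewrite size_rem // su.
  - move=> y yu; apply: uE'; first exact: mem_rem yu.
    by apply: contraNneq cx => yx; rewrite -{1}yx.
  - move=> y yE; apply: leq_trans (u1 y _); last by rewrite inE yE orbT.
    by rewrite (seq.permP pu) leq_addl.
  exists (x :: v); first by rewrite mem_cat map_f ?orbT.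
  by rewrite (perm_trans pu) ?perm_cons.
have [//|||v Mv uv] := HM1 u.
- by move=> y yu; apply: uE' => //; apply: contraNneq xu => <-.
- by move=> y yE; apply: u1; rewrite inE yE orbT.
by exists v => //; rewrite mem_cat Mv.
Qed.

(** Insertion sort by adjacent swaps: the first letter of [s] is bubbled to its place in [s'], then
    the tail is treated behind a fixed prefix. *)
Lemma perm_ind_swap (Q : seq T -> Prop) :
    (forall s1 a b s2, Q (s1 ++ [:: a, b & s2]) -> Q (s1 ++ [:: b, a & s2])) ->
  forall s s', perm_eq s s' -> Q s -> Q s'.
Proof.
move=> Qswap s s' ss' Qs.
suff: Q ([::] ++ s') by [].
elim: s s' ss' [::] {Qs}(Qs : Q ([::] ++ s)) => [|x s IHs] s' ss' pre Qs.
  by rewrite perm_sym in ss'; rewrite (perm_nilP ss').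
have xs' : x \in s' by rewrite -(perm_mem ss') mem_head.
move: ss'; case/path.splitPr: xs' => l r ss'.
have {}ss' : perm_eq s (l ++ r).
  by rewrite -(perm_cons x) (perm_trans ss') // -cat_rcons -cats1 -catA
    perm_catCA.
have bubble l' pre' : Q (pre' ++ x :: l' ++ r) -> Q (pre' ++ l' ++ x :: r).
  elim: l' pre' => [|y l' IHl] pre' //= /Qswap.
  by have := IHl (rcons pre' y); rewrite !cat_rcons.
by apply: bubble; have := IHs _ ss' (rcons pre x); rewrite !cat_rcons; apply.
Qed.

End Monomials.

(** * Brackets of homogeneous elements *)

Section Brackets.
Context {K : fieldType} {n : nat} (L : nLieSuper K n).
Implicit Types (S : set L) (x y : {ffun 'I_n -> L}).

Lemma upd_id x i : upd x i (x i) = x.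
Proof. by apply/ffunP => j; rewrite ffunE; case: eqP => [->|]. Qed.

Lemma nbr_upd0 x i : nbr (upd x i 0) = 0.
Proof.
have := nbr_linear x i (-1) 0 0; rewrite scaler0 addr0 => ->.
by rewrite scaleN1r addNr.
Qed.

Lemma nbr_eq0 x i : x i = 0 -> nbr x = 0.
Proof. by move=> xi0; rewrite -(upd_id x i) xi0 nbr_upd0. Qed.

(** Multilinearity, one slot at a time: [k] counts the leading slots that may already range over the
    spans. *)
Lemma nbr_span (G : 'I_n -> set L) S : subspace S ->
    (forall x, (forall i, G i (x i)) -> S (nbr x)) ->
  forall x, (forall i, span (G i) (x i)) -> S (nbr x).
Proof.
move=> HS HG.
suff H k : forall x,
    (forall i : 'I_n, if (i < k)%N then span (G i) (x i) else G i (x i)) ->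
    S (nbr x).
  by move=> x Hx; apply: (H n) => i; rewrite ltn_ord.
elim: k => [|k IHk] x Hx; first by apply: HG => i; have := Hx i.
have [kn|nk] := ltnP k n; last first.
  apply: IHk => i; have := Hx i.
  by rewrite (leq_trans (ltn_ord i) nk) (leq_trans (ltn_ord i) (leqW nk)).
pose i0 := Ordinal kn; rewrite -(upd_id x i0).
have := Hx i0; rewrite ltnSn.
apply: (span_min (S := [set v | S (nbr (upd x i0 v))])).
  split=> [|a u v] /=; first by rewrite nbr_upd0; case: HS.
  by rewrite nbr_linear; case: HS => _; apply.
move=> v Gv /=; apply: IHk => i; rewrite ffunE.
have := Hx i; rewrite ltnS leq_eqVlt.
have [-> _|ne] := eqVneq i i0; first by rewrite ltnn.
by case: eqP => [ik|//]; case/eqP: ne; apply: val_inj.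
Qed.

Definition homogeneous : set L := [set v | exists a, spart L a v].

Lemma span_homogeneous (v : L) : span homogeneous v.
Proof.
have [v0 [v1 [H0 H1 ->]]] := spart_sum v.
apply: subspaceD; first exact: span_subspace.
  by apply: sub_span; exists false.
by apply: sub_span; exists true.
Qed.

Lemma nbr_homogeneous x : (forall i, homogeneous (x i)) -> homogeneous (nbr x).
Proof.
by move=> /choice [d Hd]; exists (odd (\sum_(i < n) d i)); apply: nbr_degree.
Qed.

Lemma spart_disjoint (v : L) a : spart L a v -> spart L (~~ a) v -> v = 0.
Proof. by case: a => H1 H2; apply: (@spart_cap K L). Qed.

(** The bracket as a function of words, so that permutations and multiplicities of letters can be
    used. Short words are padded with 0 and long ones truncated. *)
Definition nbrs (s : seq L) : L := nbr [ffun i : 'I_n => s`_i].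

Lemma nbrs_codom x : nbrs (codom x) = nbr x.
Proof.
congr nbr; apply/ffunP => i; rewrite ffunE codomE.
by rewrite (nth_map i) ?size_enum_ord // nth_ord_enum.
Qed.

(* [spart] is not exclusive at 0, which is even for [parity]. *)
Definition parity (v : L) : bool := ~~ `[< spart L false v >].

Lemma spart_parity v : homogeneous v -> spart L (parity v) v.
Proof.
case=> a; rewrite /parity; case: asboolP => //= H0.
by case: a => // /H0.
Qed.

Lemma nbrs_swap s1 u v s2 : size (s1 ++ [:: u, v & s2]) = n ->
    {in s1 ++ [:: u, v & s2], forall w, homogeneous w} ->
  nbrs (s1 ++ [:: u, v & s2])
  = - ((-1) ^+ (parity u * parity v)%N *: nbrs (s1 ++ [:: v, u & s2])).
Proof.
move=> sn hs.
have lt1 : (size s1 < n)%N by move: sn; rewrite size_cat /=; lia.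
have lt2 : ((size s1).+1 < n)%N by move: sn; rewrite size_cat /=; lia.
pose i := Ordinal lt1; pose j := Ordinal lt2.
pose d (l : 'I_n) := parity (s1 ++ [:: u, v & s2])`_l.
rewrite /nbrs (nbr_skew (d := d) (i := i) (j := j)) /d //.
  rewrite /= !nth_cat ltnn ltnNge leqnSn /= subnn subSnn /=.
  congr (- (_ *: nbr _)); apply/ffunP => l; rewrite !ffunE.
  case: tpermP => [-> | -> | /eqP li /eqP lj] /=; rewrite !nth_cat /=.
  - by rewrite ltnn ltnNge leqnSn /= subnn subSnn.
  - by rewrite ltnn ltnNge leqnSn /= subnn subSnn.
  - case: ltnP => // le1; have : (l - size s1 >= 2)%N.
      by move: li lj; rewrite -!val_eqE /=; lia.
    by case: (_ - _)%N => [|[|]].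
by move=> l; rewrite ffunE; apply/spart_parity/hs/mem_nth; rewrite sn.
Qed.

(** An adjacent swap changes the bracket by a sign only, and a subspace absorbs signs, so the total
    sign is never computed. *)
Lemma nbrs_perm S s s' : subspace S -> size s = n ->
    {in s, forall w, homogeneous w} -> perm_eq s s' ->
  S (nbrs s) -> S (nbrs s').
Proof.
move=> HS sn hs ss'.
pose Q r := [/\ size r = n, {in r, forall w, homogeneous w} & S (nbrs r)].
suff HQ : Q s -> Q s' by move=> Ss; case: HQ.
apply: perm_ind_swap ss' => {s sn hs}s1 a b s2 [sn hs Ss].
have hp : perm_eq (s1 ++ [:: a, b & s2]) (s1 ++ [:: b, a & s2]).
  by rewrite perm_cat2l; apply/seq.permPl/(perm_catCA [:: a] [:: b]).
have sn' : size (s1 ++ [:: b, a & s2]) = n by rewrite -(perm_size hp).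
have hs' : {in s1 ++ [:: b, a & s2], forall w, homogeneous w}.
  by move=> w; rewrite -(perm_mem hp); apply: hs.
split=> //; rewrite nbrs_swap //.
by apply: subspaceN => //; apply: subspaceZ.
Qed.

(** With two copies of [x] moved to the front, swapping them shows that the bracket is its own
    opposite, and 2 is invertible. *)
Lemma nbrs_even_repeat s (x : L) : [pchar K] =i pred0 -> size s = n ->
    {in s, forall w, homogeneous w} -> spart L false x ->
  (1 < count_mem x s)%N -> nbrs s = 0.
Proof.
move=> charK sn hs x0 xs.
have xin : x \in s by rewrite -has_pred1 has_count ltnW.
have xin' : x \in rem x s.
  rewrite -has_pred1 has_count; move: xs.
  by rewrite (seq.permP (perm_to_rem xin)) /= eqxx.
have ps : perm_eq [:: x, x & rem x (rem x s)] s.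
  rewrite perm_sym (perm_trans (perm_to_rem xin)) // perm_cons.
  exact: perm_to_rem.
apply: (nbrs_perm (S := [set 0]) _ _ _ ps).
- by split=> // a u v /= -> ->; rewrite scaler0 addr0.
- by rewrite (perm_size ps).
- by move=> w; rewrite (perm_mem ps); apply: hs.
have := @nbrs_swap [::] x x (rem x (rem x s)); rewrite /= => H /=.
have {H} := H _ _; rewrite /parity asboolT //= expr0 scale1r => H.
have /eqP : nbrs [:: x, x & rem x (rem x s)] *+ 2 = 0.
  rewrite mulr2n {1}H ?addNr //; first by rewrite -(perm_size ps) in sn.
  by move=> w; rewrite (perm_mem ps); apply: hs.
by rewrite -scaler_nat scaler_eq0 ((pcharf0P K).1 charK) /= => /eqP.
Qed.

(** [bracket_with] asks for the element of [A] in slot 0. For graded [A] any slot will do: reduce to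
    homogeneous arguments, then permute slot [i] to the front. *)
Lemma bracket_withP (A : set L) x (i : 'I_n) :
    (forall v, A v -> span (homogeneous `&` A) v) ->
  A (x i) -> bracket_with A (nbr x).
Proof.
move=> gA Axi.
pose G j := if j == i then homogeneous `&` A else homogeneous.
apply: (@nbr_span G) => [||j]; first exact: span_subspace.
  move=> y Gy; have hy j : homogeneous (y j).
    by have := Gy j; rewrite /G; case: eqP => // _ [].
  have [_ Ayi] : (homogeneous `&` A) (y i) by have := Gy i; rewrite /G eqxx.
  have iny : y i \in codom y by apply: codom_f.
  have py := perm_to_rem iny; rewrite perm_sym in py.
  have sz : size (codom y) = n by rewrite size_codom card_ord.
  have hc : {in codom y, forall w, homogeneous w}.
    by move=> w /codomP [j ->].
  rewrite -nbrs_codom; apply: nbrs_perm py _; first exact: span_subspace.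
  - by move: sz; rewrite (perm_size (perm_to_rem iny)).
  - by move=> w; rewrite -(perm_mem (perm_to_rem iny)); apply: hc.
  apply: sub_span; eexists; last reflexivity.
  by move=> j j0; rewrite ffunE j0.
rewrite /G; case: eqP => [->|_]; first exact: gA.
exact: span_homogeneous.
Qed.

End Brackets.

(** * The center and a one-dimensional derived algebra *)

Section Center.
Context {K : fieldType} {n : nat} (L : nLieSuper K n).

Lemma nbr_derived (x : {ffun 'I_n -> L}) : lower_central L 2 (nbr x).
Proof. by apply: sub_span; exists x. Qed.

Lemma derived_sub (S : set L) : subspace S ->
    (forall x : {ffun 'I_n -> L}, (forall i, homogeneous (x i)) -> S (nbr x)) ->
  lower_central L 2 `<=` S.
Proof.
move=> HS Snbr; apply: span_min => // _ [x _ ->].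
apply: (nbr_span (G := fun=> @homogeneous K n L)) => // i.
exact: span_homogeneous.
Qed.

Lemma center_subspace : (0 < n)%N -> subspace (center L).
Proof.
move=> n_gt0; pose i0 := Ordinal n_gt0.
have eq_i0 (i : 'I_n) : i = 0%N :> nat -> i = i0 by move=> ?; apply: val_inj.
split=> [x x0|a u v Zu Zv x xi0].
  by apply: (nbr_eq0 (i := i0)); apply: x0.
rewrite -(upd_id x i0) (xi0 i0) // nbr_linear Zu ?Zv ?scaler0 ?addr0 //.
  by move=> i /eq_i0 ->; rewrite ffunE eqxx.
by move=> i /eq_i0 ->; rewrite ffunE eqxx.
Qed.

(** Some homogeneous bracket is nonzero and hence spans the even line. If it were not central,
    bracketing would reproduce it up to a nonzero scalar, against nilpotency. *)
Lemma derived_line :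
    nilpotent L -> sdim (lower_central L 2) 1 0 ->
  exists y : {ffun 'I_n -> L},
    [/\ forall i, homogeneous (y i), nbr y != 0, spart L false (nbr y),
        center L (nbr y) &
        lower_central L 2 `<=` [set v | exists c, v = c *: nbr y]].
Proof.
move=> [cl [Lcl _]] [[b Hb b_uniq] [b' _ odd_dim]].
have odd0 v : lower_central L 2 v -> spart L true v -> v = 0.
  by move=> v2 v1; have [//|c [/=]] := odd_dim v; rewrite big_ord0 subr0.
have even_line v : lower_central L 2 v -> spart L false v ->
    exists c, v = c *: b ord0.
  move=> v2 v0; have [//|c [/= /eqP]] := b_uniq v.
  by rewrite big_ord1 subr_eq0 => /eqP -> _; exists (c ord0).
have b_neq0 : b ord0 != 0.
  apply/eqP => b0; have [|c [_ cu]] := b_uniq 0.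
    split; first exact: (proj1 (span_subspace _)).
    exact: (proj1 (@spart_subspace K L false)).
  (* If [b ord0] were zero, the coefficients 0 and 1 would both represent the vector 0. *)
  have /ffunP /(_ ord0) : [ffun=> 0] = [ffun=> 1] :> {ffun 'I_1 -> K}.
    by transitivity c; [symmetry|]; apply: cu;
      rewrite /= big_ord1 b0 scaler0 subr0.
  by rewrite !ffunE => /eqP; rewrite eq_sym oner_eq0.
have [y hy ny0] : exists2 y : {ffun 'I_n -> L},
    (forall i, homogeneous (y i)) & nbr y != 0.
  apply: contrapT => Hno; move/eqP: b_neq0; apply.
  have [L2b _] := Hb ord0; apply: (derived_sub (S := [set 0])) L2b.
    by split=> // a u v /= -> ->; rewrite scaler0 addr0.
  move=> x hx /=; apply/eqP; apply: contrapT => /negP nx; apply: Hno.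
  by exists x.
have y0 : spart L false (nbr y).
  have [[] // ny1] := nbr_homogeneous hy.
  by rewrite (odd0 _ (nbr_derived y) ny1) eqxx in ny0.
have line : lower_central L 2 `<=` [set v | exists c, v = c *: nbr y].
  apply: derived_sub; first exact: subspace_line.
  move=> x /nbr_homogeneous [[] xa] /=.
    by exists 0; rewrite scale0r (odd0 _ (nbr_derived x)).
  have [c ->] := even_line _ (nbr_derived x) xa.
  have [c' yE] := even_line _ (nbr_derived y) y0.
  have c'0 : c' != 0 by apply: contraNneq ny0 => c0; rewrite yE c0 scale0r.
  by exists (c / c'); rewrite yE scalerA divfK.
exists y; split=> // x xz.
have [c xE] := line _ (nbr_derived x).
have [c0|c0] := eqVneq c 0; first by rewrite xE c0 scale0r.
(* A nonzero bracket with [nbr y] in slot 0 is a multiple of [nbr y], so [nbr y] survives in every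
   term of the lower central series. *)
have zc k : iter k (@bracket_with K n L) setT (nbr y).
  elim: k => [//|k IHk] /=.
  have -> : nbr y = c^-1 *: nbr x by rewrite xE scalerA mulVf ?scale1r.
  apply: subspaceZ; first exact: span_subspace.
  by apply: sub_span; exists x => // i /xz ->.
have := zc cl; rewrite -[iter _ _ _]/(lower_central L cl.+1) Lcl /= => z0.
by rewrite z0 eqxx in ny0.
Qed.

End Center.

(** * Graded presentations *)

Section Presentation.
Context {K : fieldType} {n : nat} {L F : nLieSuper K n} (f : {linear F -> L}).
Context (n_ge2 : (2 <= n)%N) (f_hom : is_hom f).
Context (f_surj : forall y : L, exists x, f x = y).

Let R : set F := [set x | f x = 0].

Lemma kernel_subspace : subspace R.
Proof.
split=> [|a u v /= fu fv]; first by rewrite /R /= linear0.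
by rewrite /R /= linearP fu fv scaler0 addr0.
Qed.

(** The images of the two homogeneous components of [v] are opposite, hence of both degrees, hence
    zero. *)
Lemma kernel_graded v : R v -> span (@homogeneous K n F `&` R) v.
Proof.
have [v0 [v1 [H0 H1 ->]]] := spart_sum v; rewrite /R /= linearD => /eqP.
rewrite addr_eq0 => /eqP fv.
have fv0 : f v0 = 0.
  apply: (@spart_disjoint K n L _ false); first exact: f_hom.1.
  rewrite fv /=; apply: subspaceN; first exact: spart_subspace.
  exact: f_hom.1.
have fv1 : f v1 = 0 by rewrite -[f v1]opprK -fv fv0 oppr0.
apply: subspaceD; first exact: span_subspace.
  by apply: sub_span; split=> //; exists false.
by apply: sub_span; split=> //; exists true.
Qed.

(** Take the component of degree [a] of any preimage; the image of the other component has both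
    degrees and vanishes. *)
Lemma lift_homogeneous a y : spart L a y -> exists2 x, spart F a x & f x = y.
Proof.
move=> Hy; have [x fx] := f_surj y.
have [v0 [v1 [H0 H1 xE]]] := spart_sum x.
have f0 := f_hom.1 _ _ H0; have f1 := f_hom.1 _ _ H1.
move: fx; rewrite xE linearD => fx.
case: a Hy => Hy.
  exists v1 => //; rewrite -fx -[LHS]add0r; congr (_ + _); symmetry.
  apply: (@spart_disjoint K n L _ false) => //=.
  rewrite -[f v0](addrK (f v1)) fx.
  by apply: subspaceB => //; apply: spart_subspace.
exists v0 => //; rewrite -fx -[LHS]addr0; congr (_ + _); symmetry.
apply: (@spart_disjoint K n L _ true) => //=.
rewrite -[f v1](addKr (f v0)) fx addrC.
by apply: subspaceB => //; apply: spart_subspace.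
Qed.

Lemma bracket_kernel (x : {ffun 'I_n -> F}) i :
  R (x i) -> bracket_with R (nbr x).
Proof. by apply: bracket_withP; exact: kernel_graded. Qed.

Lemma bracket_kernel_sub : bracket_with R `<=` R `&` lower_central F 2.
Proof.
apply: span_min.
  by apply: subspaceI; [exact: kernel_subspace | exact: span_subspace].
move=> _ [x Rx ->]; split; last exact: nbr_derived.
rewrite /R /= f_hom.2; apply: (nbr_eq0 (i := Ordinal (ltnW n_ge2))).
by rewrite ffunE; apply: Rx.
Qed.

(* Moving [nbr y] to the last place and expanding by the fundamental identity,
   every summand contains a bracket [a, ..., y_i], which lies in R because f a
   is central. *)
Lemma nbrs_central_derived (a : F) (y : {ffun 'I_n -> F}) s :
    size s = n -> {in s, forall w, homogeneous w} ->
    (forall i, homogeneous (y i)) -> center L (f a) ->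
    a \in s -> nbr y \in rem a s ->
  bracket_with R (nbrs s).
Proof.
move=> sn hs hy Za ain yin.
pose r := rem (nbr y) (rem a s).
have sr : perm_eq (a :: rcons r (nbr y)) s.
  rewrite perm_sym (perm_trans (perm_to_rem ain)) // perm_cons.
  by rewrite (perm_trans (perm_to_rem yin)) // perm_sym perm_rcons.
have sz : size (a :: r) = n.-1.
  by have := perm_size sr; rewrite sn /= size_rcons; lia.
apply: (nbrs_perm _ _ _ sr).
- exact: span_subspace.
- by rewrite (perm_size sr).
- by move=> w; rewrite (perm_mem sr); apply: hs.
pose x := [ffun i : 'I_n.-1 => (a :: r)`_i].
have xE v : nbrs (a :: rcons r v) = nbr (append_last x v).
  congr nbr; apply/ffunP => j; rewrite !ffunE -rcons_cons nth_rcons sz.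
  case: insubP => [i -> <-|]; first by rewrite ffunE.
  rewrite -leqNgt => nj; rewrite ltnNge nj /=.
  have -> : j = n.-1 :> nat.
    by apply/eqP; rewrite eqn_leq nj -ltnS prednK ?ltn_ord // ltnW.
  by rewrite eqxx.
have hx i : homogeneous (x i).
  rewrite ffunE; apply: hs; rewrite -(perm_mem sr) -rcons_cons mem_rcons inE.
  by rewrite mem_nth ?orbT // sz.
have [dx Hdx] := choice hx; have [dy Hdy] := choice hy.
rewrite xE (nfundamental Hdx Hdy); apply: subspace_sum => [|i _].
  exact: span_subspace.
apply: subspaceZ; first exact: span_subspace.
apply: (bracket_kernel (i := i)); rewrite ffunE eqxx -xE /R /= f_hom.2.
by apply: Za => j j0; rewrite !ffunE j0.
Qed.

Lemma lifted_complement a (A B : set L) d e :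
    subspace A -> subspace B -> B `<=` A ->
    sub_dim (A `&` spart L a) d -> sub_dim (B `&` spart L a) e ->
  exists E : seq F, [/\ size E = (d - e)%N,
    {in E, forall x, spart F a x}, {in E, forall x, A (f x)} &
    forall S : set L, subspace S -> B `&` spart L a `<=` S ->
      {in E, forall x, S (f x)} ->
      A `&` spart L a `<=` S].
Proof.
move=> HA HB BA dimA dimB.
have Ha := @spart_subspace K L a.
have [|||w Aw sAw] := complement_family _ _ _ dimA dimB.
- exact: subspaceI.
- exact: subspaceI.
- by move=> v [/BA].
have /choice [g Hg] : forall i, exists x, spart F a x /\ f x = w i.
  move=> i; have [_ wa] := Aw i.
  by have [x xa fx] := lift_homogeneous wa; exists x.
exists (codom g); split.
- by rewrite size_codom card_ord.
- by move=> _ /codomP [i ->]; case: (Hg i).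
- by move=> _ /codomP [i ->]; case: (Hg i) => _ ->; case: (Aw i).
move=> S HS BS ES v /sAw; apply: span_mod_min => // i.
by case: (Hg i) => _ <-; apply: ES; apply: codom_f.
Qed.

End Presentation.

(** The three summands count the words in [A0], [A1] only, those in [z], [B0], [B1] only, and the
    mixed ones without [z], split by the number [i] of letters from the first block. *)
Lemma two_block_monomials_upto_perm (T : eqType) (A0 A1 B0 B1 : seq T)
    (z : T) n :
  exists2 M : seq (seq T),
    size M =
    (\sum_(0 <= i < n.+1) 'C(size A0, i) * calL (n - i) (size A1)
     + \sum_(0 <= i < n.+1) 'C((size B0).+1, i) * calL (n - i) (size B1)
     + \sum_(1 <= i < n)
         (\sum_(0 <= j < i.+1) 'C(size A0, j) * calL (i - j) (size A1))
         * (\sum_(0 <= j < (n - i).+1)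
              'C(size B0, j) * calL (n - i - j) (size B1)))%N &
    forall s, size s = n -> {subset s <= (A0 ++ A1) ++ (z :: B0) ++ B1} ->
      {in A0 ++ z :: B0, forall x, (count_mem x s <= 1)%N} ->
      {in A0 ++ A1, forall a, a \in s -> z \notin rem a s} ->
    exists2 v, v \in M & perm_eq s v.
Proof.
have [MA /all_and2 [sMA HMA]] := choice (supermonomials_upto_perm A0 A1).
have [MB /all_and2 [sMB HMB]] := choice (supermonomials_upto_perm B0 B1).
have [MZ [sMZ HMZ]] := supermonomials_upto_perm (z :: B0) B1 n.
exists (MA n ++ MZ ++ flatten [seq [seq u ++ v | u <- MA i, v <- MB (n - i)%N]
                              | i <- index_iota 1 n]).
  rewrite !size_cat sMA sMZ addnA; congr (_ + _)%N.
  rewrite size_flatten /shape -map_comp sumnE big_map; apply: eq_bigr => i _.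
  by rewrite /= size_allpairs sMA sMB.
move=> s sn sG s1 zs.
(* A letter lying in both blocks is assigned to the first one. *)
pose sA := filter [in A0 ++ A1] s; pose sB := filter (predC [in A0 ++ A1]) s.
have sAB : perm_eq s (sA ++ sB) by rewrite perm_sym perm_filterC.
have sAs : {subset sA <= s} by move=> x; rewrite mem_filter => /andP[].
have sBs : {subset sB <= s} by move=> x; rewrite mem_filter => /andP[].
have sA_A : {subset sA <= A0 ++ A1} by move=> x; rewrite mem_filter => /andP[].
have sB_B : {subset sB <= (z :: B0) ++ B1}.
  move=> x; rewrite mem_filter => /andP[/= /negPf xA /sG].
  by rewrite mem_cat xA.
have cntA x : x \in A0 -> (count_mem x sA <= 1)%N.
  move=> xA; apply: leq_trans (s1 x _); last by rewrite mem_cat xA.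
  by rewrite (seq.permP sAB) count_cat leq_addr.
have cntB x : x \in z :: B0 -> (count_mem x sB <= 1)%N.
  move=> xB; apply: leq_trans (s1 x _); last by rewrite mem_cat xB orbT.
  by rewrite (seq.permP sAB) count_cat leq_addl.
have szAB : (size sA + size sB)%N = n by rewrite -size_cat -(perm_size sAB).
have [sB0|sBn] := eqVneq sB [::].
  rewrite sB0 cats0 in sAB; rewrite sB0 addn0 in szAB.
  have [//|//|//|v Mv pv] := HMA n sA.
  by exists v; [rewrite mem_cat Mv | apply: perm_trans pv].
have [sA0|sAn] := eqVneq sA [::].
  rewrite sA0 /= in sAB; rewrite sA0 add0n in szAB.
  have [//|//|//|v Mv pv] := HMZ sB.
  by exists v; [rewrite !mem_cat Mv orbT | apply: perm_trans pv].
have zB : z \notin sB.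
  have aA : head z sA \in sA by case: (sA) sAn => // y t _; rewrite mem_head.
  apply: contra (zs _ (sA_A _ aA) (sAs _ aA)) => zB.
  apply: rem_mem; last exact: sBs.
  by apply: contraTneq zB => ->; rewrite mem_filter /= sA_A.
have iA : (0 < size sA)%N by rewrite lt0n size_eq0.
have iB : (0 < size sB)%N by rewrite lt0n size_eq0.
have [//|//|//|u Mu pu] := HMA (size sA) sA.
have [|||v Mv pv] := HMB (n - size sA)%N sB.
- by rewrite -szAB addKn.
- move=> x xB; have := sB_B x xB; rewrite inE => /predU1P [xz|//].
  by rewrite -xz xB in zB.
- by move=> x xB; apply: cntB; rewrite inE xB orbT.
exists (u ++ v); last by rewrite (perm_trans sAB) // perm_cat.
rewrite !mem_cat; apply/orP; right; apply/orP; right.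
apply/flatten_mapP; exists (size sA); last by apply: allpairs_f.
by rewrite mem_index_iota iA -szAB -addn1 leq_add2l.
Qed.

(** * The bound on the dimension of the multiplier *)

Theorem theorem4p7 (K : fieldType) (n m k p q : nat) (L : nLieSuper K n)
    (charK : [pchar K] =i pred0) (n_ge2 : (2 <= n)%N)
    (L_nilpotent : nilpotent L)
    (dimL : sdim [set: L] m k)
    (dimZ : sdim (center L) p q)
    (dimL2 : sdim (lower_central L 2) 1 0)
    (P : free_presentation L) :
  exists2 d : nat, multiplier_dim P d &
    (d%:Z <=
     (\sum_(0 <= i < n.+1)
        ('C(p - 1, i) * calL (n - i) q
         + 'C(m - p + 1, i) * calL (n - i) (k - q))
      + \sum_(1 <= i < n)
        ((\sum_(0 <= j < i.+1) 'C(p - 1, j) * q ^ (i - j))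
         * (\sum_(0 <= j < (n - i).+1)
              'C(m - p, j) * (k - q) ^ (n - i - j))))%N%:Z - 1)%R.
Proof.
set N := (X in X%:Z - 1).
have n_gt0 : (0 < n)%N := ltnW n_ge2.
set f := fp_map P; pose F := fp_alg P.
have f_hom : is_hom f := fp_hom P.
have f_surj := fp_surj P.
have [y [hy ny0 y0 Zy L2_line]] := derived_line L_nilpotent dimL2.
have HL2 : subspace (lower_central L 2) by exact: span_subspace.
have HZ : subspace (center L) by exact: center_subspace.
have L2Z : lower_central L 2 `<=` center L.
  by move=> _ /L2_line [c ->]; exact: (subspaceZ _ HZ).
have HT : subspace [set: L] by [].
have ZT : center L `<=` [set: L] by [].
have cplt := lifted_complement f_hom f_surj.
(* [A0], [A1] lift a complement of [L^2] in the center, of dimension [(p-1|q)]; [B0], [B1] lift a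
   complement of the center in [L], of dimension [(m-p|k-q)]. *)
have [A0 [sA0 A0even A0Z genA0]] := cplt _ _ _ _ _ HZ HL2 L2Z dimZ.1 dimL2.1.
have [A1 [sA1 A1odd A1Z genA1]] := cplt _ _ _ _ _ HZ HL2 L2Z dimZ.2 dimL2.2.
have [B0 [sB0 B0even _ genB0]] := cplt _ _ _ _ _ HT HZ ZT dimL.1 dimZ.1.
have [B1 [sB1 B1odd _ genB1]] := cplt _ _ _ _ _ HT HZ ZT dimL.2 dimZ.2.
(* The entries of [y] are lifted one by one, so that the lift [z] of [nbr y] is itself a bracket in
   [F], to which the fundamental identity applies. *)
have /choice [yh Hyh] : forall i, exists x : F, homogeneous x /\ f x = y i.
  move=> i; have [a ya] := hy i.
  have [x xa fx] := lift_homogeneous f_hom f_surj ya.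
  by exists x; split=> //; exists a.
pose y' := [ffun i => yh i]; pose z := nbr y'.
have hy' i : homogeneous (y' i) by rewrite ffunE; case: (Hyh i).
have fz : f z = nbr y.
  rewrite f_hom.2; congr nbr; apply/ffunP => i; rewrite !ffunE.
  by case: (Hyh i).
have z_even : spart F false z.
  have [[] z1 //] := nbr_homogeneous hy'.
  have := f_hom.1 _ _ z1; rewrite -/z fz => y1.
  by rewrite (spart_disjoint y0 y1) eqxx in ny0.
pose G := (A0 ++ A1) ++ (z :: B0) ++ B1.
have G_hom : {in G, forall x, homogeneous x}.
  have part_hom a x : spart F a x -> homogeneous x by exists a.
  move=> x; rewrite !mem_cat inE -!orbA.
  by case/or4P => [/A0even|/A1odd|/eqP ->|/orP[/B0even|/B1odd]]; eauto.
set W := bracket_with (fp_rel P).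
have HW : subspace W by exact: span_subspace.
pose GR : set F := [set v | v \in G \/ (homogeneous v /\ fp_rel P v)].
have HGR : subspace (span GR) by exact: span_subspace.
have genF v : span GR v.
  (* The image [T] of [span GR] is shown to contain [L^2], then the center, then all of [L]; the
     error in lifting lies in the kernel, whose homogeneous elements belong to [GR]. *)
  pose T : set L := [set x | exists2 u, span GR u & f u = x].
  have HT' : subspace T.
    split=> [|a _ _ [u1 Gu1 <-] [u2 Gu2 <-]].
      by exists 0; [case: HGR | rewrite linear0].
    by exists (a *: u1 + u2); [case: HGR => _; apply | rewrite linearP].
  have TG x : x \in G -> T (f x).
    by move=> xG; exists x => //; apply: sub_span; left.
  have TL2 a : lower_central L 2 `&` spart L a `<=` T.
    move=> _ [/L2_line [c ->] _]; apply: subspaceZ => //; rewrite -fz.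
    by apply: TG; rewrite !mem_cat mem_head !orbT.
  have TZ a : center L `&` spart L a `<=` T.
    case: a; [apply: genA1 => // | apply: genA0 => //] => x xA;
      by apply: TG; rewrite !mem_cat xA ?orbT.
  have TL a : [set: L] `&` spart L a `<=` T.
    case: a; [apply: genB1 => // | apply: genB0 => //] => x xB;
      by apply: TG; rewrite !mem_cat ?inE xB ?orbT.
  have [u Gu fu] : T (f v).
    have [v0 [v1 [H0 H1 ->]]] := spart_sum (f v).
    by apply: subspaceD => //; [apply: (TL false) | apply: (TL true)].
  rewrite -[v](subrK u); apply: subspaceD => //.
  apply: (span_mono (A := @homogeneous K n F `&` fp_rel P)).
    by move=> x Hx; right.
  by apply: (kernel_graded f_hom); rewrite /= linearB fu subrr.
have [M sM HM] := two_block_monomials_upto_perm A0 A1 B0 B1 z n.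
(* The unmixed sums agree exactly, [z] accounting for the [+ 1] in [m - p + 1]; the mixed ones are
   compared by [calL_exp]. *)
have leN : (size M <= N)%N.
  rewrite sM sA0 sA1 sB0 sB1 subn0 /N big_split /= addn1.
  rewrite leq_add2l; apply: leq_sum => i _.
  by apply: leq_mul; apply: leq_sum => j _; rewrite leq_mul2l calL_exp orbT.
pose b (i : 'I_(size M)) : F := nbrs (nth [::] M i).
(* A repeated even letter gives 0, a central letter beside [z] gives an element of [W], and any
   other word is a permutation of one in [M]. *)
have b_gen s : size s = n -> {subset s <= G} -> span_mod W b (nbrs s).
  move=> sn sG.
  have s_hom : {in s, forall w, homogeneous w} by move=> w /sG/G_hom.
  have HS : subspace (span_mod W b) by apply: span_mod_subspace.
  have [[x [x_even cx]]|no_rep] :=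
      pselect (exists x, spart F false x /\ (1 < count_mem x s)%N).
    by rewrite (nbrs_even_repeat charK sn s_hom x_even cx); case: HS.
  have [[a [aA a_s zs]]|no_mix] :=
      pselect (exists a, [/\ a \in A0 ++ A1, a \in s & z \in rem a s]).
    apply: span_mod_sub.
    apply: (nbrs_central_derived n_ge2 f_hom sn s_hom hy' _ a_s zs).
    by move: aA; rewrite mem_cat => /orP[/A0Z|/A1Z].
  have [x xE|a aA a_s|v Mv pv] := HM s sn sG.
  - rewrite leqNgt; apply/negP => cx; apply: no_rep; exists x; split=> //.
    by move: xE; rewrite mem_cat inE => /or3P[/A0even|/eqP ->|/B0even].
  - by apply/negP => zs; apply: no_mix; exists a.
  have iv : (index v M < size M)%N by rewrite index_mem.
  apply: (nbrs_perm HS _ _ (s := v)).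
  - by rewrite -(perm_size pv).
  - by move=> w; rewrite -(perm_mem pv); apply: s_hom.
  - by rewrite perm_sym.
  have := span_mod_gen b (Ordinal iv) HW.
  by rewrite {2}/b /= nth_index.
have F2_gen : lower_central F 2 `<=` span_mod W b.
  apply: span_min; first exact: span_mod_subspace.
  move=> _ [x _ ->]; apply: (nbr_span (G := fun=> GR)) => //.
    exact: span_mod_subspace.
  move=> {}x GRx.
  (* One argument in the kernel puts the bracket in [W]; otherwise all arguments are letters of
     [G]. *)
  have [[i Ri]|noR] := pselect (exists i, fp_rel P (x i)).
    by apply: span_mod_sub; apply: (bracket_kernel f_hom Ri).
  rewrite -nbrs_codom; apply: b_gen; first by rewrite size_codom card_ord.
  move=> _ /codomP [i ->]; have [//|[_ Ri]] := GRx i.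
  by case: noR; exists i.
(* The numerator of the multiplier is the kernel of [f] on [F^2], and [f] maps [F^2] onto the line
   through [nbr y]. *)
have [|||||M_gt0 [b' Hb' sb']] :=
  span_mod_kernel (f := f) (z := nbr y) _ HW _ F2_gen.
- exact: span_subspace.
- by move=> i; apply: nbr_derived.
- move=> v F2v; apply: L2_line; move: v F2v; apply: span_min.
    split=> [|a u v /= Hu Hv]; first by rewrite /= linear0; case: HL2.
    by rewrite linearP; apply: HL2.2.
  by move=> _ [x _ ->] /=; rewrite f_hom.2; apply: nbr_derived.
- by move=> v /(bracket_kernel_sub n_ge2 f_hom) [].
- by exists z; [apply: nbr_derived | rewrite fz].
have [d' le_d' Hd'] := quot_dim_le HW Hb' sb'.
(* [M_gt0] makes the predecessor of [size M] agree with the integer subtraction of 1. *)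
exists d' => //; move: leN M_gt0 le_d'; case: (size M) => //; lia.
Qed.
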